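(* Let $p\ge q\ge 1$ be integers. Let $$P_{p,q}=\{(x,y)\in\mathbb{R}^{\mathcal{I}_{p,q}}\times\mathbb{R}^{A_{p,q}} : y\in F_{p,q},\ (x,y)\text{ satisfies (a) and (b)}\},$$ where (a) is $y_{(i-1,j-1)^{\searrow}}\le x_{ij}$ for all $(i,j)\in\mathcal{I}_{p,q}$, and (b) is $x(\mathrm{bar}_{i,j})\le y(\mathrm{in}^{\searrow}(\mathrm{col}_{i,j}))$ for all $(i,j)\in\mathcal{I}_{p,q}$. Let $$P^{=}_{p,q}=\{(x,y)\in P_{p,q} : x(\mathrm{row}_i)=1\text{ for all }i\in[p]\}.$$ Then $P^{=}_{p,q}$ is an extended formulation for the partitioning orbitope $O^{=}_{p,q}$, i.e., the image of $P^{=}_{p,q}$ under the orthogonal projection $(x,y)\mapsto x$ onto $\mathbb{R}^{\mathcal{I}_{p,q}}$ is $O^{=}_{p,q}$.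
   Context: Notation: $[n]=\{1,\dots,n\}$, $[n]_0=\{0,1,\dots,n\}$, $q(i)=\min\{i,q\}$, $\mathcal{I}_{p,q}=\{(i,j)\in[p]\times[q] : i\ge j\}$, $\mathrm{row}_i=\{(i,j)\in\mathcal{I}_{p,q} : j\in[q]\}$. For a vector $z\in\mathbb{R}^M$ and $N\subseteq M$, $z(N)=\sum_{e\in N}z_e$. The partitioning orbitope $O^{=}_{p,q}$ is the convex hull of all 0/1-matrices of size $p\times q$ whose columns are in lexicographically decreasing (i.e., non-increasing, with row 1 the most significant position) order and that have exactly one 1-entry per row. Since no such matrix has a 1 above its main diagonal, the entries $(i,j)$ with $i<j$ are dropped and $O^{=}_{p,q}$ is regarded as a subset of $\mathbb{R}^{\mathcal{I}_{p,q}}$. The directed acyclic graph $D_{p,q}=(V_{p,q},A_{p,q})$ has node set $V_{p,q}=\mathcal{I}_{p,q}\uplus([p]_0\times\{0\})\uplus\{s\}\uplus\{t\}$ and the following arcs: - vertical arcs $(i,j)^{\downarrow}=((i,j),(i+1,j))$ for $i\in[p-1]_0$, $j\in[q(i)]_0$; - diagonal arcs $(i,j)^{\searrow}=((i,j),(i+1,j+1))$ for $i\in[p-1]_0$, $j\in[q(i+1)-1]_0$; - the arc $(s,(0,0))$; - the arcs $((p,j),t)$ for $j\in[q]_0$. $F_{p,q}\subseteq\mathbb{R}^{A_{p,q}}$ is the set of all $s$-$t$-flows in $D_{p,q}$ of flow value one without capacity restrictions: $y\ge 0$, flow conservation at every node other than $s,t$, and one unit of flow leaving $s$. For $W\subseteq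 V_{p,q}$, $\mathrm{in}^{\searrow}(W)$ is the set of diagonal arcs $(u,w)$ with $w\in W$, $u\notin W$. For $(i,j)\in\mathcal{I}_{p,q}$: $\mathrm{bar}_{i,j}=\{(i,\ell)\in\mathcal{I}_{p,q} : \ell\ge j\}$ and $\mathrm{col}_{i,j}=\{(k,j) : j\le k\le i\}$. *)

(* Defs.v *)
From HB Require Import structures.
From mathcomp Require Import all_boot all_order all_algebra.
From mathcomp Require Import classical_sets.

Set Implicit Arguments.
Unset Strict Implicit.
Unset Printing Implicit Defensive.

Import Order.TTheory GRing.Theory Num.Theory.
Local Open Scope ring_scope.

(* The index set I_{p,q}, with rows and columns counted from 0: the element
   (i, j) stands for the pair (i+1, j+1) of the usual 1-based numbering. *)
Definition tri (p q : nat) : finType :=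
  {u : 'I_p * 'I_q | (u.2 <= u.1)%N}.

Definition trow p q (e : tri p q) : 'I_p := (val e).1.
Definition tcol p q (e : tri p q) : 'I_q := (val e).2.

Definition row_set p q (i : 'I_p) : {set tri p q} := [set e | trow e == i].

Definition bar p q (e : tri p q) : {set tri p q} :=
  [set f | (trow f == trow e) && (tcol e <= tcol f)%N].

(* The lower bound of a column segment, the diagonal, is built into [tri]. *)
Definition col_seg p q (e : tri p q) : {set tri p q} :=
  [set f | (tcol f == tcol e) && (trow f <= trow e)%N].

(* The pairs (i, j) with 0 <= j <= i <= p and j <= q, that is, I_{p,q}
   in 1-based numbering together with the extra column {0,...,p} x {0}. *)
Definition grid (p q : nat) : finType :=
  {u : 'I_p.+1 * 'I_q.+1 | (u.2 <= u.1)%N}.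

Definition grow p q (g : grid p q) : nat := (val g).1.
Definition gcol p q (g : grid p q) : nat := (val g).2.

Variant node (p q : nat) := Source | Sink | Inner of grid p q.
Arguments Source {p q}.
Arguments Sink {p q}.

Definition node_code p q (v : node p q) : option (option (grid p q)) :=
  match v with
  | Source => None
  | Sink => Some None
  | Inner g => Some (Some g)
  end.

Definition node_decode p q (o : option (option (grid p q))) : node p q :=
  match o with
  | None => Source
  | Some None => Sink
  | Some (Some g) => Inner g
  end.

Lemma node_codeK p q : cancel (@node_code p q) (@node_decode p q).
Proof. by case. Qed.

HB.instance Definition _ p q :=
  Finite.copy (node p q) (can_type (@node_codeK p q)).

(* In the next two relations the ranges of (i, j) for which the arc exists
   are enforced by both end points being nodes. *)
Definition vertical_arc p q (u v : node p q) : bool :=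
  match u, v with
  | Inner g, Inner h => (grow h == (grow g).+1) && (gcol h == gcol g)
  | _, _ => false
  end.

Definition diagonal_arc p q (u v : node p q) : bool :=
  match u, v with
  | Inner g, Inner h => (grow h == (grow g).+1) && (gcol h == (gcol g).+1)
  | _, _ => false
  end.

Definition source_arc p q (u v : node p q) : bool :=
  match u, v with
  | Source, Inner h => (grow h == 0%N) && (gcol h == 0%N)
  | _, _ => false
  end.

Definition sink_arc p q (u v : node p q) : bool :=
  match u, v with
  | Inner g, Sink => grow g == p
  | _, _ => false
  end.

Definition dag_arc (p q : nat) : finType :=
  {a : node p q * node p q |
    [|| vertical_arc a.1 a.2, diagonal_arc a.1 a.2, source_arc a.1 a.2
      | sink_arc a.1 a.2]}.

Definition arc_tail p q (a : dag_arc p q) : node p q := (val a).1.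
Definition arc_head p q (a : dag_arc p q) : node p q := (val a).2.

Definition in_diag p q (W : {set node p q}) : {set dag_arc p q} :=
  [set a | [&& diagonal_arc (arc_tail a) (arc_head a), arc_head a \in W & arc_tail a \notin W]].

Lemma tri_shift_proof p q (e : tri p q) :
  (lift ord0 (tcol e) <= lift ord0 (trow e))%N.
Proof. by rewrite !lift0 ltnS; exact: valP e. Qed.

(* The inclusion of I_{p,q} into the node set; it adds 1 to both coordinates
   since [tri] is 0-based and [grid] is not. *)
Definition tri_node p q (e : tri p q) : node p q :=
  Inner (exist (fun u : 'I_p.+1 * 'I_q.+1 => (u.2 <= u.1)%N)
           (lift ord0 (trow e), lift ord0 (tcol e)) (tri_shift_proof e)).

Definition tri_pred_node p q (e : tri p q) : node p q :=
  Inner (exist (fun u : 'I_p.+1 * 'I_q.+1 => (u.2 <= u.1)%N)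
           (widen_ord (leqnSn p) (trow e), widen_ord (leqnSn q) (tcol e))
           (valP e)).

Lemma diag_arc_proof p q (e : tri p q) :
  let u := tri_pred_node e in let v := tri_node e in
  [|| vertical_arc u v, diagonal_arc u v, source_arc u v | sink_arc u v].
Proof. by rewrite /= /grow /gcol /= !eqxx orbT. Qed.

(* The diagonal arc from (i-1, j-1) to (i, j), where (i, j) is the 1-based
   name of [e]. *)
Definition diag_arc p q (e : tri p q) : dag_arc p q :=
  exist (fun a : node p q * node p q =>
           [|| vertical_arc a.1 a.2, diagonal_arc a.1 a.2, source_arc a.1 a.2
             | sink_arc a.1 a.2])
    (tri_pred_node e, tri_node e) (diag_arc_proof e).

Definition is_unit_flow (R : realFieldType) p q (y : {ffun dag_arc p q -> R}) :=
  [/\ forall a, 0 <= y a,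
      forall v, v != Source -> v != Sink ->
        \sum_(a | arc_head a == v) y a = \sum_(a | arc_tail a == v) y a
    & \sum_(a | arc_tail a == Source) y a = 1].

Local Open Scope classical_set_scope.

Definition flow_polytope (R : realFieldType) p q : set {ffun dag_arc p q -> R} :=
  [set y | is_unit_flow y].

Definition P_ext (R : realFieldType) p q :
    set ({ffun tri p q -> R} * {ffun dag_arc p q -> R}) :=
  [set xy : {ffun tri p q -> R} * {ffun dag_arc p q -> R} |
    let: (x, y) := xy in
    [/\ flow_polytope y,
      forall e : tri p q, y (diag_arc e) <= x e
    & forall e : tri p q,
        \sum_(f in bar e) x f
          <= \sum_(a in in_diag [set tri_node f | f in col_seg e]%SET) y a]].

Definition P_ext_eq (R : realFieldType) p q :
    set ({ffun tri p q -> R} * {ffun dag_arc p q -> R}) :=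
  [set xy : {ffun tri p q -> R} * {ffun dag_arc p q -> R} |
    P_ext xy /\ forall i : 'I_p, \sum_(e in row_set q i) xy.1 e = 1].

Arguments P_ext_eq R p q : clear implicits.

Definition convex_hull (R : realFieldType) (V : lmodType R) (A : set V) :
    set V :=
  [set v | exists n (c : 'I_n -> R) (w : 'I_n -> V),
    [/\ forall k, 0 <= c k, \sum_k c k = 1, forall k, A (w k)
      & v = \sum_k c k *: w k]].

(* Columns as tuples, compared in the lexicographic order of the library with
   the top entry most significant. *)
Definition col_tuple (R : realFieldType) p q (M : 'M[R]_(p, q)) (j : 'I_q) :
    p.-tuplelexi R :=
  [tuple M i j | i < p].

Definition orbitopal_matrices (R : realFieldType) p q : set 'M[R]_(p, q) :=
  [set M : 'M[R]_(p, q) | [/\ forall i j, M i j = 0 \/ M i j = 1,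
      forall j k : 'I_q, (j <= k)%N -> (col_tuple M k <= col_tuple M j)%O
    & forall i, exists! j, M i j = 1]].

Arguments orbitopal_matrices R p q : clear implicits.

Definition drop_upper (R : realFieldType) p q (M : 'M[R]_(p, q)) :
    {ffun tri p q -> R} :=
  [ffun e => M (trow e) (tcol e)].

Definition partitioning_orbitope (R : realFieldType) p q :
    set {ffun tri p q -> R} :=
  [set drop_upper M | M in convex_hull (orbitopal_matrices R p q)].

Arguments partitioning_orbitope R p q : clear implicits.

(* Main.v *)
Require Import Defs.
From mathcomp Require Import all_boot all_order all_algebra.
From mathcomp Require Import boolp classical_sets.
From mathcomp Require Import zify lra.

Set Implicit Arguments.
Unset Strict Implicit.
Unset Printing Implicit Defensive.

(* A point of the partitioning orbitope is a convex combination of restricted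
   growth strings s: s_i is the column of the 1 in row i, and column c may be
   used only once the columns before it have been opened.  The number of opened
   columns traces an s-t-path whose diagonal arcs are the openings.  Conversely,
   (b) says that in every row the mass x - y(diagonal) still to be placed is
   dominated, from the right, by the flow on vertical arcs, and the row equations
   make the totals equal; a monotone coupling therefore distributes the flow of
   the vertical arc in column j over columns <= j.  Normalised, these couplings
   together with the diagonal arcs are the transition kernels of a Markov chain
   that produces restricted growth strings and has x as its marginals. *)

Import Order.TTheory GRing.Theory Num.Theory.
Local Open Scope ring_scope.

(** * Couplings and restricted growth strings *)

(** The comonotone coupling, whose joint tail is the minimum of the two marginal tails, moves mass
    only to the right when the tails of [v] dominate those of [d]. *)
Lemma monotone_coupling (R : realFieldType) (n : nat) (d v : nat -> R) :
  (forall l, (l < n)%N -> 0 <= d l) -> (forall l, (l < n)%N -> 0 <= v l) ->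
  (forall j, (j < n)%N -> \sum_(j <= l < n) d l <= \sum_(j <= l < n) v l) ->
  \sum_(0 <= l < n) d l = \sum_(0 <= l < n) v l ->
  exists T : nat -> nat -> R,
    [/\ forall l k, 0 <= T l k,
        forall l k, (k < l)%N -> T l k = 0,
        forall l, (l < n)%N -> \sum_(k < n) T l k = d l
      & forall k, (k < n)%N -> \sum_(l < n) T l k = v k].
Proof.
move=> d0 v0 dv0 dvE.
pose tail (w : nat -> R) j := \sum_(j <= l < n) w l.
have tailn w : tail w n = 0 by rewrite /tail big_geq.
have tailS w l : (l < n)%N -> tail w l = w l + tail w l.+1.
  by move=> ln; rewrite /tail big_ltn.
have tail_anti w : (forall l, (l < n)%N -> 0 <= w l) ->
    {homo tail w : j k / (j <= k)%N >-> k <= j}.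
  move=> w0 j k jk; rewrite -(subnK jk); elim: (k - j)%N => // m IH.
  apply: le_trans IH; rewrite addSn; have [mn|nm] := ltnP (m + j) n.
    by rewrite (tailS _ _ mn) lerDr w0.
  by rewrite /tail !big_geq // (leq_trans nm).
have dv j : tail d j <= tail v j.
  by have [/dv0//|nj] := ltnP j n; rewrite /tail !big_geq.
have tail_ge0 w j : (forall l, (l < n)%N -> 0 <= w l) -> 0 <= tail w j.
  by move=> w0; rewrite /tail big_nat; apply: sumr_ge0 => l /andP[_ /w0].
have telescope (f : nat -> R) : \sum_(k < n) (f k - f k.+1) = f 0%N - f n.
  rewrite -(big_mkord xpredT (fun k => f k - f k.+1)) -[RHS]opprB.
  by rewrite -telescope_sumr // -sumrN; apply: eq_bigr => k _; rewrite opprB.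
(* The coupling is the mixed second difference of the copula min. *)
pose mn l k := Num.min (tail d l) (tail v k).
exists (fun l k => (mn l k - mn l k.+1) - (mn l.+1 k - mn l.+1 k.+1)); split.
- move=> l k; rewrite /mn.
  have := tail_anti d d0 _ _ (leqnSn l); have := tail_anti v v0 _ _ (leqnSn k).
  by case: (lerP (tail d l) (tail v k)); case: (lerP (tail d l.+1) (tail v k));
     case: (lerP (tail d l) (tail v k.+1));
     case: (lerP (tail d l.+1) (tail v k.+1)); lra.
- move=> l k kl; rewrite /mn.
  (* For [k < l] dominance puts both tails of [d] below both tails of [v]; all four minima are tails
     of [d], and the differences in [k] vanish. *)
  have h1 := le_trans (tail_anti d d0 _ _ kl) (dv k.+1).
  have h2 := tail_anti v v0 _ _ (leqnSn k).
  have h3 := tail_anti d d0 _ _ (leqnSn l).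
  by rewrite !min_l ?subrr //; lra.
- move=> l ln; rewrite sumrB !telescope.
  (* Here equality of the totals enters: [tail v 0] is [tail d 0], which bounds every tail of
     [d]. *)
  have mn0 j : mn j 0 = tail d j by rewrite /mn /(tail v 0) -dvE min_l ?tail_anti.
  have mnn j : mn j n = 0 by rewrite /mn tailn min_r ?tail_ge0.
  by rewrite !mn0 !mnn (tailS d) //; lra.
- move=> k kn; rewrite (eq_bigr (fun l : 'I_n => (mn l k - mn l k.+1)
    - (mn l.+1 k - mn l.+1 k.+1))); last by move=> l _; lra.
  rewrite (telescope (fun l => mn l k - mn l k.+1)).
  have mn0 j : mn 0 j = tail v j by rewrite /mn /(tail d 0) dvE min_r ?tail_anti.
  have mnn j : mn n j = 0 by rewrite /mn tailn min_l ?tail_ge0.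
  by rewrite !mn0 !mnn (tailS v) //; lra.
Qed.
(** For a restricted growth string the letters in use are exactly those below this number, so it
    counts the nonzero columns. *)
Definition opened (s : seq nat) : nat := (\max_(l <- s) l.+1)%N.

Lemma opened_rcons s l : opened (rcons s l) = maxn (opened s) l.+1.
Proof. by rewrite /opened -cats1 big_cat big_seq1. Qed.

(** The usual code of a set partition of the rows: each row reuses an opened column or, in the case
    of equality, opens the next one. *)
Definition restricted_growth (s : seq nat) : Prop :=
  forall i, (i < size s)%N -> (nth 0%N s i <= opened (take i s))%N.

Lemma restricted_growth_rcons s l :
  restricted_growth s -> (l <= opened s)%N -> restricted_growth (rcons s l).
Proof.
move=> gs ls i; rewrite size_rcons ltnS leq_eqVlt => /orP[/eqP->|i_lt].
  by rewrite nth_rcons ltnn eqxx -cats1 take_size_cat.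
by rewrite nth_rcons i_lt -cats1 takel_cat ?gs // ltnW.
Qed.

(* The state j is the number of opened columns, N i j its probability before row
   i, and K i j l the probability of emitting l in state j; L is the law of the
   emitted string. *)
Lemma markov_chain_strings (R : realFieldType) (n q : nat)
    (N : nat -> nat -> R) (K : nat -> nat -> nat -> R) :
  (forall i j l, (i < n)%N -> 0 <= K i j l) ->
  (forall i j, (i < n)%N -> (j <= q)%N -> \sum_(l < q | (l <= j)%N) K i j l = 1) ->
  (forall h : nat -> R, \sum_(j < q.+1) N 0 j * h j = h 0) ->
  (forall i (h : nat -> R), (i < n)%N ->
    \sum_(j < q.+1) N i.+1 j * h j =
    \sum_(j < q.+1) N i j *
      \sum_(l < q | (l <= j)%N) K i j l * h (maxn j l.+1)) ->
  exists L : seq (R * seq nat),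
    [/\ forall z, z \in L -> [/\ 0 <= z.1, size z.2 = n, restricted_growth z.2
          & (opened z.2 <= q)%N],
        \sum_(z <- L) z.1 = 1
      & forall i l, (i < n)%N -> (l < q)%N ->
          \sum_(z <- L) z.1 * (nth 0%N z.2 i == l)%:R =
          \sum_(j < q.+1 | (l <= j)%N) N i j * K i j l].
Proof.
move=> K_ge0 K_sum N0 NS.
(* The induction also needs the law of the final state, expressed by test functions [h]; constant
   [h] then gives total mass one. *)
suff [L [L1 L2 L3]] : exists L : seq (R * seq nat),
    [/\ forall z, z \in L -> [/\ 0 <= z.1, size z.2 = n, restricted_growth z.2
          & (opened z.2 <= q)%N],
        forall h : nat -> R,
          \sum_(z <- L) z.1 * h (opened z.2) = \sum_(j < q.+1) N n j * h j
      & forall i l, (i < n)%N -> (l < q)%N ->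
          \sum_(z <- L) z.1 * (nth 0%N z.2 i == l)%:R =
          \sum_(j < q.+1 | (l <= j)%N) N i j * K i j l].
  have tot i : (i <= n)%N -> \sum_(j < q.+1) N i j * 1 = 1.
    elim: i => [_|i IH i_lt]; first exact: (N0 (fun=> 1)).
    rewrite (NS _ (fun=> 1)) // -[RHS](IH (ltnW i_lt)).
    apply: eq_bigr => j _; congr (_ * _); rewrite -[RHS](K_sum i j) -1?ltnS //.
    by apply: eq_bigr => l _; rewrite mulr1.
  exists L; split=> //; rewrite -(tot n) // -(L2 (fun=> 1)).
  by apply: eq_bigr => z _; rewrite mulr1.
elim: n K_ge0 K_sum NS => [|n IH] K_ge0 K_sum NS.
  exists [:: (1, [::])]; split=> // [z|h].
    by rewrite inE => /eqP-> /=; split; rewrite // /opened big_nil.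
  by rewrite big_seq1 N0 /opened big_nil mul1r.
have [i j l /ltnW|i j /ltnW|i h /ltnW|L [L1 L2 L3]] := IH;
  [exact: K_ge0|exact: K_sum|exact: NS|].
(* Every string is prolonged by each admissible letter, its weight being split according to the
   kernel. *)
pose step (z : R * seq nat) l := (z.1 * K n (opened z.2) l, rcons z.2 l).
pose L' := [seq step z l | z <- L, l <- [seq l <- iota 0 q | l <= opened z.2]%N].
have sumL' (f : R * seq nat -> R) : \sum_(z <- L') f z =
    \sum_(z <- L) \sum_(l < q | (l <= opened z.2)%N) f (step z l).
  rewrite /L' big_allpairs_dep; apply: eq_bigr => z _.
  by rewrite big_filter -{1}(subn0 q) -/(index_iota 0 q) big_mkord.
exists L'; split.
- move=> _ /allpairsPdep[z [l [/L1[z0 zn zg zq] + ->]]].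
  rewrite mem_filter mem_iota => /andP[l_op /= l_lt].
  split=> /=; rewrite ?mulr_ge0 ?K_ge0 ?size_rcons ?zn //.
    exact: restricted_growth_rcons.
  by rewrite opened_rcons geq_max zq.
- move=> h; rewrite sumL' NS //.
  rewrite -(L2 (fun j => \sum_(l < q | (l <= j)%N) K n j l * h (maxn j l.+1))).
  apply: eq_bigr => z _.
  rewrite mulr_sumr; apply: eq_bigr => l _.
  by rewrite /= opened_rcons mulrA.
- move=> i l; rewrite ltnS leq_eqVlt => /orP[/eqP->|i_lt] l_lt; rewrite sumL'.
    (* The probability that the new letter is [l], as a function of the state, so that [L2]
       applies. *)
    pose h j := if (l <= j)%N then K n j l else 0.
    transitivity (\sum_(z <- L) z.1 * h (opened z.2)); last first.
      by rewrite L2 [RHS]big_mkcond; apply: eq_bigr => j _; rewrite /h; case: ifP; rewrite ?mulr0.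
    apply: eq_big_seq => z /L1[_ zn _ _].
    under eq_bigr => k _ do rewrite /= nth_rcons zn ltnn eqxx -[k == l :> nat]/(val k == val (Ordinal l_lt)) val_eqE.
    rewrite /h big_mkcond (bigD1 (Ordinal l_lt)) //= eqxx mulr1.
    rewrite big1 ?addr0; first by case: ifP; rewrite ?mulr0.
    by move=> k /negPf ->; rewrite mulr0 if_same.
  (* Earlier letters keep their law because the kernel sums to one. *)
  rewrite -L3 //; apply: eq_big_seq => z /L1[_ zn _ zq].
  under eq_bigr => k _ do rewrite /= nth_rcons zn i_lt mulrAC.
  by rewrite -mulr_sumr K_sum // mulr1.
Qed.

(** * Restricted growth strings as orbitopal matrices *)

Lemma opened_take_le s i : (opened (take i s) <= opened s)%N.
Proof. by rewrite -{2}(cat_take_drop i s) /opened big_cat leq_maxl. Qed.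

Lemma nth_lt_opened s i : (i < size s)%N -> (nth 0%N s i < opened s)%N.
Proof.
move=> i_lt; rewrite (leq_trans _ (opened_take_le s i.+1)) //.
by rewrite (take_nth 0%N) // opened_rcons leq_maxr.
Qed.

Lemma restricted_growth_take s i :
  restricted_growth s -> restricted_growth (take i s).
Proof.
move=> gs k; rewrite size_take_min leq_min => /andP[ki ks].
by rewrite nth_take // take_takel ?gs // ltnW.
Qed.

(** No letter is skipped: the last letter is at most [opened] of the prefix, so all smaller letters
    already occur in the prefix. *)
Lemma restricted_growth_mem s l :
  restricted_growth s -> (l < opened s)%N -> l \in s.
Proof.
elim/last_ind: s => [_|s a IH gs]; first by rewrite /opened big_nil.
rewrite opened_rcons mem_rcons inE leq_max ltnS => l_lt.
have [//|la /=] := eqVneq l a; apply: IH.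
  by move/restricted_growth_take: gs => /(_ (size s)); rewrite -cats1 take_size_cat.
have := gs (size s); rewrite size_rcons -cats1 take_size_cat // nth_cat ltnn subnn /=.
by move=> /(_ (leqnn _)); lia.
Qed.

Lemma restricted_growth_orbitopal (R : realFieldType) p q s :
  size s = p -> restricted_growth s -> (opened s <= q)%N ->
  orbitopal_matrices R p q (\matrix_(i, j) (nth 0%N s i == j)%:R).
Proof.
move=> sp gs sq.
have s_lt (i : 'I_p) : (nth 0%N s i < q)%N.
  by apply: leq_trans sq; apply: nth_lt_opened; rewrite sp.
split=> [i j|j k jk|i].
- by rewrite mxE; case: eqP; [right|left].
- move: jk; rewrite leq_eqVlt => /orP[/eqP/val_inj->//|jk].
  apply/lexi_tupleP.
  (* Columns [j] and [k] first differ in the row where [j] is opened. If [j] never occurs, [index]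
     returns [p], the witness that stands for equal columns. *)
  have ij : (index (val j) s < p.+1)%N by rewrite ltnS -sp index_size.
  exists (Ordinal ij) => i /= i_le; rewrite !tnth_mktuple !mxE.
  move: i_le; rewrite leq_eqVlt => /orP[/eqP i_eq|i_lt].
    have -> : nth 0%N s i = j by rewrite i_eq nth_index // -index_mem -i_eq sp.
    rewrite !eqxx i_eq eqxx (ltn_eqF jk) /=.
    by split; rewrite ?ler01 // eq_sym oner_eq0.
  have sij : (nth 0%N s i == j) = false := before_find 0%N i_lt.
  (* A letter [k] above that row would require [j < k] to have been opened before it. *)
  have sik : nth 0%N s i != k.
    apply: contraTneq i_lt => ik; rewrite -leqNgt.
    have := gs i; rewrite sp ltn_ord ik => /(_ isT) k_le.
    have := restricted_growth_mem (restricted_growth_take (i := i) gs) (leq_trans jk k_le).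
    by rewrite in_take_leq ?sp ?(ltnW (ltn_ord i)) // => /ltnW.
  by rewrite sij (negbTE sik) (ltn_eqF i_lt); split; rewrite ?lexx ?eqxx.
- exists (Ordinal (s_lt i)); split=> [|j]; rewrite mxE ?eqxx //=.
  case: eqP => [e _|_ /eqP]; first exact/val_inj.
  by rewrite eq_sym oner_eq0.
Qed.

Lemma orbitopal_restricted_growth (R : realFieldType) p q (M : 'M[R]_(p, q)) :
  orbitopal_matrices R p q M ->
  exists s : seq nat, [/\ size s = p, restricted_growth s, (opened s <= q)%N
    & M = \matrix_(i, j) (nth 0%N s i == j)%:R].
Proof.
move=> [M01 M_lex M_row].
have /choice[f fP] : forall i, exists j, forall k, M i k = (j == k)%:R.
  move=> i; have [j [Mij jP]] := M_row i; exists j => k.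
  case: eqP => [<-//|jk]; case: (M01 i k) => // /jP; congruence.
pose s := [seq val (f i) | i <- enum 'I_p].
have sp : size s = p by rewrite size_map size_enum_ord.
have nths (i : 'I_p) : nth 0%N s i = f i.
  by rewrite (nth_map i) ?size_enum_ord // nth_ord_enum.
exists s; split=> //.
- move=> i; rewrite sp => ip; rewrite -[i]/(val (Ordinal ip)) nths leqNgt.
  set i' := Ordinal ip; apply/negP => m_lt.
  have m_ltq : (opened (take i s) < q)%N := ltn_trans m_lt (ltn_ord _).
  (* If row [i] skipped the next unopened column, that column would be zero through row [i], while
     column [f i'] to its right has a 1 there, against the lexicographic order. *)
  have /lexi_tupleP[k kP] := M_lex (Ordinal m_ltq) (f i') (ltnW m_lt).
  have [ik|ki] := leqP i k.
    have := kP i' ik; rewrite !tnth_mktuple !fP eqxx => -[+ _].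
    by rewrite -val_eqE /= gtn_eqF // ler10.
  have kp := ltn_trans ki ip.
  have [] := kP (Ordinal kp) (leqnn k); rewrite !tnth_mktuple !fP eqxx.
  have [fk _ _|_] := eqVneq (f (Ordinal kp)) (Ordinal m_ltq).
    have : (nth 0%N (take i s) k < opened (take i s))%N.
      by rewrite nth_lt_opened // size_take_min leq_min ki sp kp.
    by rewrite nth_take // -[X in nth _ _ X]/(val (Ordinal kp)) nths fk ltnn.
  by case: eqP => _; rewrite ?ler10 ?eqxx.
- by apply/bigmax_leqP_seq => l /mapP[i _ ->] _; apply: ltn_ord.
- by apply/matrixP => i j; rewrite mxE nths fP.
Qed.
(** * The path of a restricted growth string *)

Lemma arc_inj p q (a b : dag_arc p q) :
  arc_tail a = arc_tail b -> arc_head a = arc_head b -> a = b.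
Proof.
move=> tab hab; apply: val_inj.
by rewrite [LHS]surjective_pairing [RHS]surjective_pairing; congr pair.
Qed.

Lemma eq_Inner p q (g h : grid p q) :
  (Inner g == Inner h :> node p q) = (grow g == grow h) && (gcol g == gcol h).
Proof.
apply/eqP/andP => [[->]//|[/eqP gr /eqP gc]]; congr Inner; apply: val_inj.
by rewrite [LHS]surjective_pairing [RHS]surjective_pairing; congr pair; apply: val_inj.
Qed.

Lemma tri_node_coord p q (e : tri p q) :
  exists2 g, tri_node e = Inner g & grow g = (trow e).+1 /\ gcol g = (tcol e).+1.
Proof. by eexists; [reflexivity|rewrite /grow /gcol /= /bump !leq0n !add1n]. Qed.

Lemma tri_pred_node_coord p q (e : tri p q) :
  exists2 g, tri_pred_node e = Inner g & grow g = trow e /\ gcol g = tcol e.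
Proof. by eexists. Qed.

Lemma diag_arc_inj p q : injective (@diag_arc p q).
Proof.
move=> e f ef; have : tri_pred_node e = tri_pred_node f.
  exact: (congr1 (@arc_tail p q) ef).
have [g -> [gr gc]] := tri_pred_node_coord e.
have [h -> [hr hc]] := tri_pred_node_coord f.
move=> /eqP; rewrite eq_Inner gr gc hr hc => /andP[/eqP r /eqP c]; apply: val_inj.
by rewrite [LHS]surjective_pairing [RHS]surjective_pairing; congr pair; apply: val_inj.
Qed.

(** The tail of a diagonal arc lies one column to the left of its head, hence outside the segment;
    the right-hand side of (b) thus becomes a sum over cells. *)
Lemma in_diag_col_seg p q (e : tri p q) :
  in_diag [set tri_node f | f in col_seg e] = [set diag_arc f | f in col_seg e].
Proof.
apply/setP=> a; rewrite !inE; apply/and3P/imsetP => [[da /imsetP[f fe fa] _]|[f fe ->]].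
  exists f => //; apply: arc_inj => //.
  have [h hE [hr hc]] := tri_node_coord f; have [g gE [gr gc]] := tri_pred_node_coord f.
  move: da; rewrite fa hE; case: (arc_tail a) => //= g'.
  rewrite hr hc !eqSS => da; apply/eqP; rewrite /arc_tail /= gE eq_Inner gr gc.
  by rewrite eq_sym (eq_sym (gcol g')).
split; first 2 last.
- apply/imsetP => -[f' f'e]; rewrite /arc_tail /=.
  have [h -> [_ hc]] := tri_node_coord f'; have [g -> [_ gc]] := tri_pred_node_coord f.
  move=> /eqP; rewrite eq_Inner gc hc => /andP[_].
  by move: fe f'e; rewrite !inE => /andP[/eqP-> _] /andP[/eqP-> _]; rewrite ltn_eqF.
- rewrite -[X in is_true X]/(diagonal_arc (tri_pred_node f) (tri_node f)).
  have [h -> [hr hc]] := tri_node_coord f; have [g -> [gr gc]] := tri_pred_node_coord f.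
  by rewrite /= hr gr hc gc !eqxx.
- exact: imset_f.
Qed.

(** Every arc raises this rank by one, so an s-t-path has one node per level and can be given as a
    function of the level. *)
Definition level p q (v : node p q) : nat :=
  match v with Source => 0 | Inner g => (grow g).+1 | Sink => p.+2 end.

Lemma level_arc p q (a : dag_arc p q) :
  level (arc_head a) = (level (arc_tail a)).+1.
Proof.
case: a => -[[||g] [||h]] //= P; rewrite /arc_head /arc_tail /=.
- by move: P; rewrite orbF => /andP[/eqP->].
- by move/eqP: P => ->.
- by move: P; rewrite !orbF => /orP[]/andP[/eqP->].
Qed.

Lemma level_le p q (v : node p q) : (level v <= p.+2)%N.
Proof. by case: v => //= g; rewrite ltnS ltnW // ltn_ord. Qed.

Definition path_flow (R : realFieldType) p q (P : nat -> node p q) :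
    {ffun dag_arc p q -> R} :=
  [ffun a => ((arc_tail a == P (level (arc_tail a)))
              && (arc_head a == P (level (arc_head a))))%:R].

Section PathFlow.
Variables (R : realFieldType) (p q : nat) (P : nat -> node p q).
Hypothesis level_P : forall k, (k <= p.+2)%N -> level (P k) = k.
Hypothesis arc_P : forall k, (k <= p.+1)%N ->
  exists a : dag_arc p q, arc_tail a = P k /\ arc_head a = P k.+1.

(** Levels leave a single candidate for the path arc into [v]. Inflow here and outflow in
    [path_flow_tail] are the same indicator of [v] lying on the path, which gives conservation. *)
Lemma path_flow_head v : (0 < level v)%N ->
  \sum_(a | arc_head a == v) path_flow R P a = (v == P (level v))%:R.
Proof.
case lv : (level v) => [//|k] _.
have [vP|vP] := eqVneq v (P k.+1); last first.
  by apply: big1 => a /eqP av; rewrite ffunE av lv (negbTE vP) andbF.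
have kp : (k <= p.+1)%N by rewrite -ltnS -lv level_le.
have [a [ta ha]] := arc_P kp.
have lP : level (P k) = k by rewrite level_P // ltnW.
rewrite (bigD1 a) ?ha ?vP //= ffunE ta ha lP level_P // !eqxx big1 ?addr0 //.
move=> b /andP[/eqP hb ba]; rewrite ffunE hb.
have [tb|//] := eqVneq (arc_tail b) _.
have lb : level (arc_tail b) = k.
  by apply: succn_inj; rewrite -level_arc hb level_P.
case/negP: ba; apply/eqP/arc_inj; last by rewrite hb ha.
by rewrite tb lb ta.
Qed.

Lemma path_flow_tail v : (level v <= p.+1)%N ->
  \sum_(a | arc_tail a == v) path_flow R P a = (v == P (level v))%:R.
Proof.
set k := level v => kp.
have [vP|vP] := eqVneq v (P k); last first.
  by apply: big1 => a /eqP av; rewrite ffunE av (negbTE vP).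
have [a [ta ha]] := arc_P kp.
rewrite (bigD1 a) ?ta ?vP //= ffunE ta ha !level_P ?(leqW kp) // !eqxx big1 ?addr0 //.
move=> b /andP[/eqP tb ba]; rewrite ffunE tb andbC.
have [hb|//] := eqVneq (arc_head b) _.
have lb : level (arc_head b) = k.+1.
  by rewrite level_arc tb level_P ?(leqW kp).
case/negP: ba; apply/eqP/arc_inj; first by rewrite tb ta.
by rewrite hb lb ha.
Qed.

Lemma path_flow_unit : is_unit_flow (path_flow R P).
Proof.
split=> [a|v vs vt|]; first by rewrite ffunE ler0n.
- case: v vs vt => // g _ _; rewrite path_flow_head ?path_flow_tail //=.
  by rewrite ltn_ord.
- rewrite path_flow_tail //=; case: (P 0) (level_P (leq0n _)) => //.
Qed.

End PathFlow.

(* Sink is the intended value at k = p.+2, and a junk value where (i, m i) is not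
   a grid node. *)
Definition row_node p q (m : nat -> nat) (k : nat) : node p q :=
  match k with
  | 0 => Source
  | i.+1 => oapp (@Inner p q) Sink
      (if (i <= p)%N then insub (inord i : 'I_p.+1, inord (m i) : 'I_q.+1)
       else None : option (grid p q))
  end.

Lemma opened_take_S s i : restricted_growth s ->
  (opened (take i.+1 s) <= (opened (take i s)).+1)%N.
Proof.
move=> gs; have [si|si] := leqP (size s) i.
  by rewrite !take_oversize // leqW.
by rewrite (take_nth 0%N) // opened_rcons geq_max leqnSn ltnS gs.
Qed.

Lemma opened_take_leq s i : restricted_growth s -> (opened (take i s) <= i)%N.
Proof.
move=> gs; elim: i => [|i IH]; first by rewrite take0 /opened big_nil.
by rewrite (leq_trans (opened_take_S i gs)).
Qed.

(** * The lift of a restricted growth string to the extended formulation *)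

Section GrowthPath.
Variables (R : realFieldType) (p q : nat) (s : seq nat).
Hypotheses (sp : size s = p) (gs : restricted_growth s) (sq : (opened s <= q)%N).

Let m i := opened (take i s).
Let P := row_node p q m.

Lemma row_nodeP i : (i <= p)%N ->
  exists2 g, P i.+1 = Inner g & grow g = i /\ gcol g = m i.
Proof.
move=> ip; rewrite /P /= ip.
have mi : (m i <= i)%N by apply: opened_take_leq.
have mq : (m i <= q)%N := leq_trans (opened_take_le _ _) sq.
case: insubP => [g _ gE|] /=; last by rewrite !inordK ?mi.
by exists g => //; rewrite /grow /gcol gE /= !inordK.
Qed.

Lemma row_node_level k : (k <= p.+2)%N -> level (P k) = k.
Proof.
case: k => [//|k]; rewrite ltnS leq_eqVlt => /orP[/eqP->|kp].
  by rewrite /P /= ltnn.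
by have [g -> [/= ->]] := row_nodeP kp.
Qed.

Lemma row_node_arc k : (k <= p.+1)%N ->
  exists a : dag_arc p q, arc_tail a = P k /\ arc_head a = P k.+1.
Proof.
move=> kp.
suff aP : [|| vertical_arc (P k) (P k.+1), diagonal_arc (P k) (P k.+1),
    source_arc (P k) (P k.+1) | sink_arc (P k) (P k.+1)].
  by exists (Sub (P k, P k.+1) aP).
case: k kp => [_|k].
  have [g -> [/= -> ->]] := row_nodeP (leq0n p).
  by rewrite /m take0 /opened big_nil.
rewrite ltnS => kp; have [g -> [gr gc]] := row_nodeP kp.
move: kp; rewrite leq_eqVlt => /orP[/eqP kp|kp].
  by rewrite kp /P /= ltnn /= gr kp eqxx.
have [h -> [hr hc]] := row_nodeP kp; rewrite /= gr gc hr hc eqxx /= !orbF.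
rewrite /m (take_nth 0%N) ?sp // opened_rcons.
have := gs; move=> /(_ k); rewrite sp kp => /(_ isT); rewrite -/(m k); lia.
Qed.

Lemma path_flow_diag (e : tri p q) :
  path_flow R P (diag_arc e) =
  ((m (trow e) == tcol e) && (m (trow e).+1 == (tcol e).+1))%:R.
Proof.
have ep := ltn_ord (trow e).
have [g gE [gr gc]] := row_nodeP (ltnW ep).
have [h hE [hr hc]] := row_nodeP ep.
have tl : level (arc_tail (diag_arc e)) = (trow e).+1 by [].
have hl : level (arc_head (diag_arc e)) = (trow e).+2 by rewrite level_arc.
rewrite ffunE tl hl gE hE !eq_Inner gr gc hr hc /grow /gcol /= /bump !leq0n !add1n !eqxx /=.
by rewrite eq_sym [X in _ && X]eq_sym.
Qed.

(** Stated for arbitrary subsets of a row so as to serve both the bars of (b) and the row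
    equations. *)
Lemma row_indicator_sum (i : 'I_p) : exists2 f : tri p q,
  trow f = i /\ tcol f = nth 0%N s i :> nat &
  forall A : {set tri p q}, A \subset row_set q i ->
    \sum_(e in A) drop_upper (\matrix_(i, j) (nth 0%N s i == j)%:R) e
      = (f \in A)%:R :> R.
Proof.
have ip : (i < size s)%N by rewrite sp.
have s_lt : (nth 0%N s i < q)%N := leq_trans (nth_lt_opened ip) sq.
have s_le : (nth 0%N s i <= i)%N := leq_trans (gs ip) (opened_take_leq i gs).
pose f : tri p q := exist (fun u : 'I_p * 'I_q => (u.2 <= u.1)%N) (i, Ordinal s_lt) s_le.
exists f => // A /fintype.subsetP Ai.
have off e : e \in A -> e != f ->
    drop_upper (\matrix_(i, j) (nth 0%N s i == j)%:R) e = 0 :> R.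
  move=> eA ef; rewrite ffunE mxE; have /Ai := eA; rewrite inE => /eqP ei.
  case: eqP => // se; case/eqP: ef; apply: val_inj.
  rewrite [LHS]surjective_pairing -/(trow e) -/(tcol e) ei /=; congr pair.
  by apply: val_inj; rewrite /= -ei se.
have [fA|fA] := boolP (f \in A); last first.
  by apply: big1 => e eA; rewrite off //; apply: contraNneq fA => <-.
rewrite (bigD1 f) //= ffunE mxE eqxx big1 ?addr0 // => e /andP[eA ef].
exact: off.
Qed.

Lemma growth_P_ext :
  P_ext_eq R p q (drop_upper (\matrix_(i, j) (nth 0%N s i == j)%:R), path_flow R P).
Proof.
have mS i : (i < p)%N -> m i.+1 = maxn (m i) (nth 0%N s i).+1.
  by move=> ip; rewrite /m (take_nth 0%N) ?sp // opened_rcons.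
split; [split|].
- exact: path_flow_unit row_node_level row_node_arc.
- move=> e; rewrite path_flow_diag !ffunE mxE ler_nat.
  (* The path takes the diagonal arc of [e] only if the letter of that row opens column [tcol e],
     and then the entry at [e] is 1. *)
  case: eqP => //= me; rewrite mS // me.
  by case: eqP => //; case: eqP => //; lia.
- move=> e.
  have [f [fr fc] ->] := row_indicator_sum (trow e); last first.
    by apply/fintype.subsetP => f'; rewrite !inE => /andP[].
  rewrite in_diag_col_seg big_imset /=; last by move=> ? ? _ _; apply: diag_arc_inj.
  have flow0 a : 0 <= path_flow R P a by rewrite ffunE ler0n.
  rewrite inE fr eqxx fc /=; case: leqP => [ef|_]; last exact: sumr_ge0.
  have jm : (tcol e < m (trow e).+1)%N by rewrite mS // leq_max ltnS ef orbT.
  (* If the 1 of the row lies in the bar, column [tcol e] is open by then. The least prefix length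
     with it open is some [k.+1], so row [k] opened it, and its diagonal arc enters the column
     segment. *)
  have exk : exists k, (tcol e < m k)%N by exists (trow e).+1.
  have [[|k] jk kmin] := ex_minnP exk; first by move: jk; rewrite /m take0 /opened big_nil.
  have ke : (k <= trow e)%N by rewrite -ltnS kmin.
  have mk : m k = tcol e.
    have := opened_take_S k gs; rewrite -!/(m _).
    have [/kmin|] := ltnP (tcol e) (m k); [by rewrite ltnn|lia].
  have mk1 : m k.+1 = (tcol e).+1 by have := opened_take_S k gs; rewrite -!/(m _); lia.
  have kp : (k < p)%N := leq_ltn_trans ke (ltn_ord _).
  have jlek : (tcol e <= k)%N by rewrite -mk; apply: opened_take_leq.
  pose f' : tri p q := exist (fun u : 'I_p * 'I_q => (u.2 <= u.1)%N) (Ordinal kp, tcol e) jlek.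
  rewrite (bigD1 f') ?inE ?eqxx //= path_flow_diag /= mk mk1 !eqxx lerDl.
  exact: sumr_ge0.
- move=> i /=; have [f [fr fc] ->] := row_indicator_sum i; last exact: fintype.subxx.
  by rewrite inE fr eqxx.
Qed.
End GrowthPath.
(** * Unit flows *)

(** The extension of [F] by zero to all pairs of naturals, which frees index arithmetic from
    membership proofs. *)
Definition cell_sum (R : realFieldType) p q (F : tri p q -> R) (i j : nat) : R :=
  \sum_(e | (trow e == i :> nat) && (tcol e == j :> nat)) F e.

Section CellSum.
Variables (R : realFieldType) (p q : nat) (F : tri p q -> R).

Lemma cell_sumE e : cell_sum F (trow e) (tcol e) = F e.
Proof.
apply: big_pred1 => f /=; apply/andP/eqP => [[/eqP r /eqP c]|->//].
apply: val_inj; rewrite [LHS]surjective_pairing [RHS]surjective_pairing.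
by congr pair; apply: val_inj.
Qed.

Lemma cell_sum_out i j : ~~ [&& (i < p)%N, (j < q)%N & (j <= i)%N] ->
  cell_sum F i j = 0.
Proof.
move=> out; apply: big_pred0 => e; apply: contraNF out => /andP[/eqP<- /eqP<-].
by rewrite !ltn_ord; exact: (valP e).
Qed.

Lemma cell_sum_ge0 i j : (forall e, 0 <= F e) -> 0 <= cell_sum F i j.
Proof. by move=> F0; apply: sumr_ge0. Qed.

Lemma cell_sum_bar e :
  \sum_(f in bar e) F f = \sum_(tcol e <= l < q) cell_sum F (trow e) l.
Proof.
rewrite big_geq_mkord (partition_big (@tcol p q) (fun l : 'I_q => (tcol e <= l)%N)) /=; last first.
  by move=> f; rewrite inE => /andP[].
apply: eq_bigr => l el; apply: eq_bigl => f; rewrite inE -!val_eqE /=.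
by case: (tcol f =P l :> nat) => [->|]; rewrite ?andbF ?el ?andbT.
Qed.

Lemma cell_sum_row (i : 'I_p) :
  \sum_(f in row_set q i) F f = \sum_(0 <= l < q) cell_sum F i l.
Proof.
rewrite big_mkord (partition_big (@tcol p q) xpredT) //=.
by apply: eq_bigr => l _; apply: eq_bigl => f; rewrite inE -!val_eqE.
Qed.

Lemma cell_sum_col e :
  \sum_(f in col_seg e) F f = \sum_(k < (trow e).+1) cell_sum F k (tcol e).
Proof.
rewrite (partition_big (@trow p q) (fun k : 'I_p => (k <= trow e)%N)); last first.
  by move=> f; rewrite inE => /andP[].
rewrite (big_ord_widen p (fun k => cell_sum F k (tcol e))) //=.
apply: eq_big => // k ke; apply: eq_bigl => f; rewrite inE -!val_eqE /= andbC.
by case: (trow f =P k :> nat) => [->|]; rewrite ?andbF ?ke ?andbT.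
Qed.

End CellSum.

Definition at_pos p q (i j : nat) (v : node p q) : bool :=
  if v is Inner g then (grow g == i) && (gcol g == j) else false.

(** Counted on entering arcs, so the source arc contributes at the origin; positions off the grid
    get 0. *)
Definition node_flow (R : realFieldType) p q (y : {ffun dag_arc p q -> R}) i j : R :=
  \sum_(a | at_pos i j (arc_head a)) y a.

Definition down_flow (R : realFieldType) p q (y : {ffun dag_arc p q -> R}) i j : R :=
  \sum_(a | at_pos i j (arc_tail a) && at_pos i.+1 j (arc_head a)) y a.

Definition diag_flow (R : realFieldType) p q (y : {ffun dag_arc p q -> R}) :
    nat -> nat -> R :=
  cell_sum (fun e => y (diag_arc e)).

(** * Flow conservation in grid coordinates *)

Section UnitFlow.
Variables (R : realFieldType) (p q : nat) (y : {ffun dag_arc p q -> R}).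
Hypothesis y_flow : is_unit_flow y.

(** The 0-based coordinates of a cell are the grid coordinates of the tail of its diagonal arc. *)
Lemma diag_flowE i j : diag_flow y i j =
  \sum_(a | at_pos i j (arc_tail a) && at_pos i.+1 j.+1 (arc_head a)) y a.
Proof.
transitivity (\sum_(a in [set diag_arc e |
    e in [set e : tri p q | (trow e == i :> nat) && (tcol e == j :> nat)]]) y a).
  rewrite big_imset /=; last by move=> ? ? _ _; apply: diag_arc_inj.
  by apply: eq_bigl => e; rewrite inE.
apply: eq_bigl => a; apply/imsetP/andP => [[e] + ->|[]].
  rewrite inE => /andP[/eqP er /eqP ec]; rewrite /arc_tail /arc_head.
  have [h hE [hr hc]] := tri_node_coord e; have [g gE [gr gc]] := tri_pred_node_coord e.
  rewrite -[X in at_pos i j X]/(tri_pred_node e).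
  rewrite -[X in at_pos i.+1 _ X]/(tri_node e) hE gE.
  by rewrite /= hr hc gr gc er ec !eqxx.
case at_ : (arc_tail a) => [||g] //= /andP[/eqP gr /eqP gc].
case ah_ : (arc_head a) => [||h] //= /andP[/eqP hr /eqP hc].
have ip : (i < p)%N by have := ltn_ord (val h).1; rewrite -/(grow h) hr ltnS.
have jq : (j < q)%N by have := ltn_ord (val h).2; rewrite -/(gcol h) hc ltnS.
have ji : (j <= i)%N by have := valP g; rewrite -/(grow g) -/(gcol g) gr gc.
exists (exist (fun u : 'I_p * 'I_q => (u.2 <= u.1)%N) (Ordinal ip, Ordinal jq) ji).
  by rewrite inE /= !eqxx.
set e := exist _ _ _.
have [h' hE [hr' hc']] := tri_node_coord e; have [g' gE [gr' gc']] := tri_pred_node_coord e.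
apply: arc_inj.
  by rewrite at_ -[RHS]/(tri_pred_node e) gE; apply/eqP; rewrite eq_Inner gr gc gr' gc' !eqxx.
by rewrite ah_ -[RHS]/(tri_node e) hE; apply/eqP; rewrite eq_Inner hr hc hr' hc' !eqxx.
Qed.

Lemma down_flow_ge0 i j : 0 <= down_flow y i j.
Proof. by case: y_flow => y0 _ _; apply: sumr_ge0. Qed.

Lemma node_flow_ge0 i j : 0 <= node_flow y i j.
Proof. by case: y_flow => y0 _ _; apply: sumr_ge0. Qed.

Lemma diag_flow_ge0 i j : 0 <= diag_flow y i j.
Proof. by case: y_flow => y0 _ _; apply: cell_sum_ge0. Qed.

Lemma node_flow_in i j : node_flow y i.+1 j.+1 = down_flow y i j.+1 + diag_flow y i j.
Proof.
rewrite diag_flowE /node_flow (bigID (fun a : dag_arc p q => at_pos i j.+1 (arc_tail a))) /=.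
congr (_ + _); apply: eq_bigl => a; first by rewrite andbC.
case: a => -[[||g] [||h]] //= P; rewrite /arc_tail /arc_head /= ?andbF //.
  by move: P; rewrite orbF => /andP[/eqP->].
by move: P; rewrite !orbF => /orP[]/andP[/eqP-> /eqP->]; lia.
Qed.

Lemma node_flow_in0 i : node_flow y i.+1 0 = down_flow y i 0.
Proof.
apply: eq_bigl => -[[[||g] [||h]] //= P]; rewrite /arc_tail /arc_head /= ?andbF //.
  by move: P; rewrite orbF => /andP[/eqP->].
by move: P; rewrite !orbF => /orP[]/andP[/eqP-> /eqP->]; lia.
Qed.

Lemma node_flow_out i j : (i < p)%N -> node_flow y i j = down_flow y i j + diag_flow y i j.
Proof.
move=> ip; rewrite diag_flowE.
(* Off the grid all flows vanish; at a node conservation applies, and [i < p] rules out a sink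
   arc. *)
have [/existsP[g /andP[/eqP gr /eqP gc]]|no] :=
    boolP [exists g : grid p q, (grow g == i) && (gcol g == j)]; last first.
  have out (v : node p q) : at_pos i j v = false.
    by case: v => //= g; apply: contraNF no => gij; apply/existsP; exists g.
  by rewrite /node_flow /down_flow !big_pred0 ?addr0 // => a; rewrite !out.
have atE (v : node p q) : at_pos i j v = (v == Inner g).
  by case: v => //= h; rewrite eq_Inner gr gc.
case: y_flow => _ cons _.
transitivity (\sum_(a | arc_tail a == Inner g) y a).
  by rewrite -cons //; apply: eq_bigl => a; rewrite atE.
rewrite (bigID (fun a : dag_arc p q => at_pos i.+1 j (arc_head a))) /=.
congr (_ + _); apply: eq_bigl => a; rewrite atE //.
case: eqP => //= ag; case: a ag => -[[||g'] [||h]] //= P;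
  rewrite /arc_tail /arc_head //=; last first.
  by case=> e; move: P; rewrite e !orbF gr gc => /orP[]/andP[/eqP-> /eqP->]; lia.
by case=> e; move: P; rewrite e gr ltn_eqF.
Qed.

Lemma node_flow0 j : node_flow y 0 j = (j == 0%N)%:R.
Proof.
case: y_flow => _ _ src; case: j => [|j] /=.
  rewrite -src; apply: eq_bigl => -[[[||g] [||h]] //= P]; rewrite /arc_tail /arc_head /= ?andbF //.
    by move: P; rewrite orbF.
  by move: P; rewrite !orbF => /orP[]/andP[/eqP-> _].
apply: big_pred0 => a; case: (arc_head a) => //= g; apply/negbTE/negP.
by move=> /andP[/eqP g0 /eqP gj]; have := valP g; rewrite -/(grow g) -/(gcol g) g0 gj.
Qed.

Lemma diag_flow_last i : diag_flow y i q = 0.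
Proof. by apply: cell_sum_out; rewrite ltnn andbF. Qed.

(** Flow is to the right of column [j] exactly if it has left that column diagonally in an earlier
    row. This turns the right-hand side of (b) into a tail of the node flow. *)
Lemma node_flow_tail i j : (i <= p)%N -> (j <= q)%N ->
  \sum_(j <= l < q) node_flow y i l.+1 = \sum_(k < i) diag_flow y k j.
Proof.
move=> + jq; elim: i => [_|i IH ip].
  by rewrite big_ord0 big1 // => l _; rewrite node_flow0.
rewrite big_ord_recr -IH ?(ltnW ip) //=; apply/eqP.
rewrite addrC -subr_eq -sumrB; apply/eqP.
transitivity (- (\sum_(j <= l < q) (diag_flow y i l.+1 - diag_flow y i l))).
  by rewrite -sumrN; apply: eq_bigr => l _; rewrite node_flow_in node_flow_out //; lra.
by rewrite telescope_sumr // diag_flow_last; lra.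
Qed.

Lemma node_flow_total i : (i <= p)%N ->
  node_flow y i 0 + \sum_(0 <= l < q) node_flow y i l.+1 = 1.
Proof.
elim: i => [_|i IH ip].
  by rewrite node_flow0 big1 ?addr0 // => l _; rewrite node_flow0.
rewrite -[RHS](IH (ltnW ip)) !node_flow_tail ?(ltnW ip) // big_ord_recr /=.
by rewrite node_flow_in0 node_flow_out //; lra.
Qed.

End UnitFlow.

(** * Both inclusions *)

(** All constraints are preserved by convex combinations, so the path flows of the vertices are
    combined with the coefficients of [x]. *)
Lemma orbitope_P_ext (R : realFieldType) p q x :
  partitioning_orbitope R p q x -> exists y, P_ext_eq R p q (x, y).
Proof.
case=> M [n [c [w [c0 c1 wP ->]]]] <-.
have /choice[y yP] : forall k, exists y, P_ext_eq R p q (drop_upper (w k), y).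
  move=> k; have [s [sp gs sq ->]] := orbitopal_restricted_growth (wP k).
  by eexists; exact: growth_P_ext.
have dropE (e : tri p q) :
    drop_upper (\sum_k c k *: w k) e = \sum_k c k * drop_upper (w k) e.
  rewrite ffunE summxE; apply: eq_bigr => k _.
  by rewrite mxE ffunE.
have sum_drop (A : {set tri p q}) : \sum_(e in A) drop_upper (\sum_k c k *: w k) e
    = \sum_k c k * \sum_(e in A) drop_upper (w k) e.
  under eq_bigr do rewrite dropE.
  by rewrite exchange_big; apply: eq_bigr => k _; rewrite mulr_sumr.
pose z : {ffun dag_arc p q -> R} := [ffun a => \sum_k c k * y k a].
have sum_z (P : pred (dag_arc p q)) :
    \sum_(a | P a) z a = \sum_k c k * \sum_(a | P a) y k a.
  under eq_bigr do rewrite ffunE.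
  by rewrite exchange_big; apply: eq_bigr => k _; rewrite mulr_sumr.
exists z; split; [split; [split|..]|].
- move=> a; rewrite ffunE; apply: sumr_ge0 => k _.
  by case: (yP k) => -[[y0 _ _] _ _] _; rewrite mulr_ge0.
- move=> v vs vt; rewrite !sum_z; apply: eq_bigr => k _; congr (_ * _).
  by case: (yP k) => -[[_ yc _] _ _] _; apply: yc.
- rewrite sum_z -[RHS]c1; apply: eq_bigr => k _.
  by case: (yP k) => -[[_ _ ->] _ _] _; rewrite mulr1.
- move=> e; rewrite dropE ffunE; apply: ler_sum => k _.
  by case: (yP k) => -[_ + _] _ => /(_ e); apply: ler_wpM2l.
- move=> e; rewrite sum_drop sum_z; apply: ler_sum => k _.
  by case: (yP k) => -[_ _ +] _ => /(_ e); apply: ler_wpM2l.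
- move=> i; rewrite /= sum_drop -[RHS]c1; apply: eq_bigr => k _.
  by case: (yP k) => _ /(_ i) /= ->; rewrite mulr1.
Qed.

(** Subtracting the diagonal flow of row [i] from both sides of (b) leaves the dominance that
    [monotone_coupling] requires. Index [k] of [T] stands for the vertical arc in grid column
    [k.+1]. *)
Lemma P_ext_coupling (R : realFieldType) p q x y (i : 'I_p) :
  P_ext_eq R p q (x, y) ->
  node_flow y i.+1 0 = 0 /\ exists T : nat -> nat -> R,
    [/\ forall l k, 0 <= T l k,
        forall l k, (k < l)%N -> T l k = 0,
        forall l, (l < q)%N ->
          \sum_(k < q) T l k = cell_sum x i l - diag_flow y i l
      & forall k, (k < q)%N -> \sum_(l < q) T l k = down_flow y i k.+1].
Proof.
case=> -[y_flow yx xy] x_row.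
have bar_le j : (j < q)%N -> (j <= i)%N -> \sum_(j <= l < q) cell_sum x i l <=
    \sum_(j <= l < q) node_flow y i.+1 l.+1.
  move=> jq ji.
  pose e : tri p q := exist (fun u : 'I_p * 'I_q => (u.2 <= u.1)%N) (i, Ordinal jq) ji.
  have := xy e; rewrite in_diag_col_seg big_imset /=; last first.
    by move=> ? ? _ _; apply: diag_arc_inj.
  by rewrite cell_sum_bar cell_sum_col -node_flow_tail // ltnW.
have row1 : \sum_(0 <= l < q) cell_sum x i l = 1 by rewrite -cell_sum_row; apply: x_row.
have q0 : (0 < q)%N.
  rewrite lt0n; apply/eqP => qE; move/eqP: row1.
  by rewrite big_geq ?qE // eq_sym oner_eq0.
have tot := node_flow_total y_flow (ltn_ord i).
(* The bar of the whole row has mass 1, so (b) forces the whole unit of flow out of grid column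
   0. *)
have node0 : node_flow y i.+1 0 = 0.
  have := bar_le 0%N q0 (leq0n _); rewrite row1.
  by have := node_flow_ge0 y_flow i.+1 0; lra.
split=> //.
have yx_cell l : diag_flow y i l <= cell_sum x i l by apply: ler_sum.
have downE j : \sum_(j <= l < q) down_flow y i l.+1 = \sum_(j <= l < q) node_flow y i.+1 l.+1
    - \sum_(j <= l < q) diag_flow y i l.
  by rewrite -sumrB; apply: eq_bigr => l _; rewrite node_flow_in // addrK.
apply: monotone_coupling.
- by move=> l _; rewrite subr_ge0.
- by move=> l _; apply: down_flow_ge0.
- move=> j jq; have [ji|ij] := leqP j i.
    by rewrite sumrB downE lerB // bar_le.
  (* To the right of the diagonal there are no cells, so the left-hand side is 0. *)
  rewrite [leLHS]big_nat big1; first by apply: sumr_ge0 => l _; apply: down_flow_ge0.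
  move=> l /andP[jl _]; have il := leq_trans ij jl.
  by rewrite /diag_flow !cell_sum_out ?subrr // [(l <= i)%N]leqNgt il !andbF.
- by rewrite sumrB downE row1; lra.
Qed.

Lemma P_ext_orbitope (R : realFieldType) p q x y : (0 < q)%N ->
  P_ext_eq R p q (x, y) -> partitioning_orbitope R p q x.
Proof.
move=> q0 Pxy; have [[y_flow _ _] _] := Pxy.
have /choice[T TP] : forall i, exists T : nat -> nat -> R, (i < p)%N ->
    [/\ forall l k, 0 <= T l k,
        forall l k, (k < l)%N -> T l k = 0,
        forall l, (l < q)%N ->
          \sum_(k < q) T l k = cell_sum x i l - diag_flow y i l
      & forall k, (k < q)%N -> \sum_(l < q) T l k = down_flow y i k.+1].
  move=> i; have [ip|ip] := ltnP i p; last by exists (fun=> fun=> 0).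
  by have [_ [T TP]] := P_ext_coupling (Ordinal ip) Pxy; exists T.
have down0 i : (i < p)%N -> down_flow y i 0 = 0.
  move=> ip; rewrite -node_flow_in0.
  by have [] := P_ext_coupling (Ordinal ip) Pxy.
(* The joint mass of state [j] and letter [l] in row [i]: the coupled share of the vertical arc,
   plus the diagonal arc if [l] opens a column. State 0 has no vertical flow. *)
pose G i j l := (if j is j'.+1 then T i l j' else 0) + (l == j)%:R * diag_flow y i j.
(* In states of probability zero the kernel emits letter 0, which is admissible in every state. *)
pose K i j l := if node_flow y i j == 0 then (l == 0%N)%:R else G i j l / node_flow y i j.
have G_ge0 i j l : (i < p)%N -> 0 <= G i j l.
  move=> /TP[T0 _ _ _]; rewrite addr_ge0 ?mulr_ge0 ?ler0n ?diag_flow_ge0 //.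
  by case: j.
(* Vertical mass stays in state [j], as its letters are below [j]; diagonal mass passes to
   [j.+1]. *)
have sumG i j (h : nat -> R) : (i < p)%N -> (j <= q)%N ->
    \sum_(l < q | (l <= j)%N) G i j l * h (maxn j l.+1)
    = down_flow y i j * h j + diag_flow y i j * h j.+1.
  move=> ip jq; have [_ T0 _ Tcol] := TP _ ip.
  rewrite big_mkcond (eq_bigr (fun l : 'I_q =>
    (if j is j'.+1 then T i l j' else 0) * h j
    + (if l == j :> nat then diag_flow y i j * h j.+1 else 0))); last first.
    move=> l _; rewrite /G; have [lj|jl|->] := ltngtP l j.
    - by rewrite mul0r !addr0 (maxn_idPl lj).
    - by case: j jq jl => [|j] jq jl; rewrite ?T0 ?mul0r ?addr0 // ltnW.
    - rewrite mul1r (maxn_idPr (leqnSn j)).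
      by case: j jq => [|j] jq; rewrite ?T0 // !(mul0r, add0r).
  rewrite big_split /= -mulr_suml; congr (_ + _).
    case: j jq => [|j] jq; last by rewrite Tcol.
    by rewrite big1 // down0.
  rewrite -big_mkcond /=; move: jq; rewrite leq_eqVlt => /orP[/eqP->|jq].
    rewrite diag_flow_last mul0r big1 //.
  by rewrite (big_pred1 (Ordinal jq)).
have sumG1 i j : (i < p)%N -> (j <= q)%N ->
    \sum_(l < q | (l <= j)%N) G i j l = node_flow y i j.
  move=> ip jq; rewrite node_flow_out //.
  have := sumG i j (fun=> 1) ip jq; rewrite !mulr1 => <-.
  by apply: eq_bigr => l _; rewrite mulr1.
have NK i j l : (i < p)%N -> (j <= q)%N -> (l < q)%N -> (l <= j)%N ->
    node_flow y i j * K i j l = G i j l.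
  move=> ip jq lq lj; rewrite /K; case: eqP => [N0|/eqP N0]; last first.
    by rewrite mulrC divfK.
  rewrite N0 mul0r; have /esym := sumG1 i j ip jq; rewrite N0 => /esym.
  move=> /psumr_eq0P sum0.
  by rewrite (sum0 _ (Ordinal lq)) // => l' _; apply: G_ge0.
have [||h|i h ip|L [LP L1 LX]] := @markov_chain_strings R p q (node_flow y) K.
- move=> i j l ip; rewrite /K; case: ifP => _; first exact: ler0n.
  by rewrite divr_ge0 ?G_ge0 ?node_flow_ge0.
- move=> i j ip jq; have [N0|N0] := eqVneq (node_flow y i j) 0; last first.
    apply: (mulfI N0); rewrite mulr1 -[RHS](sumG1 i j) // mulr_sumr.
    by apply: eq_bigr => l lj; rewrite NK.
  rewrite /K N0 eqxx (bigD1 (Ordinal q0)) //= big1 ?addr0 // => l /andP[_].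
  by rewrite -val_eqE /= => /negPf ->.
- rewrite big_ord_recl node_flow0 // mul1r big1 ?addr0 // => j _.
  by rewrite node_flow0 // mul0r.
(* The node flow of row [i.+1], split by entering arcs, is regrouped by the tails of these arcs. *)
- transitivity (\sum_(j < q.+1) (down_flow y i j * h j + diag_flow y i j * h j.+1)).
    rewrite big_split /= big_ord_recl [X in _ = _ + X]big_ord_recr /=.
    rewrite diag_flow_last mul0r addr0 [X in _ = X + _]big_ord_recl /=.
    rewrite node_flow_in0 -addrA -big_split; congr (_ + _).
    by apply: eq_bigr => j _; rewrite /= /bump !add1n node_flow_in // mulrDl.
  apply: eq_bigr => j _; rewrite -sumG // -1?ltnS // mulr_sumr.
  by apply: eq_bigr => l lj; rewrite mulrA NK // -ltnS.
have LX' (e : tri p q) :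
    \sum_(z <- L) z.1 * (nth 0%N z.2 (trow e) == tcol e)%:R = x e.
  rewrite LX // -[RHS](cell_sumE x e).
  have ip := ltn_ord (trow e); have [_ T0 Trow _] := TP _ ip.
  move: (nat_of_ord (trow e)) (nat_of_ord (tcol e)) (ltn_ord (tcol e)) ip T0 Trow.
  move=> i l lq ip T0 Trow.
  (* Summed over the states, the coupling contributes [x] minus the diagonal flow, and the diagonal
     term restores the rest. *)
  transitivity (\sum_(j < q.+1) G i j l).
    rewrite [LHS]big_mkcond; apply: eq_bigr => j _; case: leqP => [lj|jl].
      by rewrite NK // -ltnS.
    rewrite /G gtn_eqF // mul0r addr0; case: (nat_of_ord j) jl => // j' jl.
    by rewrite T0 // ltnW.
  rewrite /G big_split /= big_ord_recl add0r Trow //.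
  rewrite (bigD1 (Ordinal (leqW lq))) //= eqxx mul1r big1 ?addr0 ?subrK // => j.
  by rewrite -val_eqE /= eq_sym => /negPf ->; rewrite mul0r.
pose z0 : R * seq nat := (0, [::]).
pose w (k : 'I_(size L)) : 'M[R]_(p, q) :=
  \matrix_(i, j) (nth 0%N (nth z0 L k).2 i == j)%:R.
exists (\sum_(k < size L) (nth z0 L k).1 *: w k).
  exists (size L), (fun k => (nth z0 L k).1), w; split=> // [k||k].
  - by have [] := LP _ (mem_nth z0 (ltn_ord k)).
  - by rewrite -L1 (big_nth z0) big_mkord.
  - have [_ zp zg zq] := LP _ (mem_nth z0 (ltn_ord k)).
    exact: restricted_growth_orbitopal.
apply/ffunP => e; rewrite ffunE summxE -LX' (big_nth z0) big_mkord.
by apply: eq_bigr => k _; rewrite !mxE.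
Qed.

Local Open Scope classical_set_scope.

Theorem corollary8 (R : realFieldType) (p q : nat) (hpq : (1 <= q <= p)%N) :
  [set xy.1 | xy in P_ext_eq R p q] = partitioning_orbitope R p q.
Proof.
have /andP[q0 _] := hpq; apply/seteqP; split=> [_ [[x y] Pxy <-]|x xO].
  exact: P_ext_orbitope Pxy.
by have [y Pxy] := orbitope_P_ext xO; exists (x, y).
Qed.
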